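(* Of the functions $\{e_\pi\}_{\pi\vdash[n],n\ge1}$, $\{h_\pi\}_{\pi\vdash[n],n\ge1}$, $\{m_\pi\}_{\pi\vdash[n],n\ge1}$ and $\{p_\pi\}_{\pi\vdash[n],n\ge1}$ in $\mathrm{NCSym}$ and their scalar multiples, only the functions $\{e_\pi\}_{\pi\vdash[n],n\ge1}$ can be realized as $Y_G$ for some graph $G$. That is, if $b\in\{e,h,m,p\}$, $\pi\vdash[n]$ with $n\ge1$, $c\in\mathbb{Q}$, and $c\,b_\pi=Y_G$ for some labelled graph $G$, then the function $c\,b_\pi$ is equal to $e_\sigma$ for some set partition $\sigma$; and in particular, for every set partition $\pi\vdash[n]$, $n\geq 1$, $$e_\pi=Y_{K_\pi}.$$
   Context: All graphs are finite, simple and labelled: a graph $G$ with $n$ vertices has its vertices labelled bijectively by $[n]=\{1,\dots,n\}$; write $v_i$ for the vertex labelled $i$. Let $x_1,x_2,\dots$ be noncommuting variables. A proper colouring of $G$ is a map $\kappa$ from the vertices to $\{1,2,\dots\}$ with $\kappa(u)\ne\kappa(v)$ whenever $u,v$ are adjacent. $Y_G=\sum_\kappa x_{\kappa(v_1)}\cdots x_{\kappa(v_n)}\in\mathbb{Q}\langle\langle x_1,x_2,\dots\rangle\rangle$, summed over all proper colourings $\kappa$ of $G$. A set partition $\pi=B_1/\cdots/B_\ell\vdash[n]$ is a family of disjoint nonempty sets (blocks) with union $[n]$. Set partitions of $[n]$ are ordered by refinement ($\pi\le\sigma$ iff every block of $\pi$ is contained in a block of $\sigma$), giving the partition lattice $\Pi_n$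 with Möbius function $\mu_\Pi$ and minimum $\hat0_n=1/2/\cdots/n$. The graph $K_\pi$ is the disjoint union of complete graphs $K_{|B_1|}\cup\cdots\cup K_{|B_\ell|}$, where the vertices of $K_{|B_i|}$ are labelled by the elements of $B_i$. For $\pi\vdash[n]$ define (sums over tuples $(i_1,\dots,i_n)$ of positive integers): - $m_\pi=\sum x_{i_1}\cdots x_{i_n}$ over tuples with $i_j=i_k$ if and only if $j,k$ are in the same block of $\pi$; - $p_\pi=\sum x_{i_1}\cdots x_{i_n}$ over tuples with $i_j=i_k$ whenever $j,k$ are in the same block of $\pi$; - $e_\pi=\sum x_{i_1}\cdots x_{i_n}$ over tuples with $i_j\neq i_k$ whenever $j\neq k$ are in the same block of $\pi$; - $h_\pi=\sum_{\sigma\le\pi}|\mu_\Pi(\hat0_n,\sigma)|\,p_\sigma$. $\mathrm{NCSym}\subset\mathbb{Q}\langle\langle x_1,x_2,\dots\rangle\rangle$ is the algebra spanned by $1$ and all $m_\pi$. Coincidences between the families (such as $e_{\hat0_n}=h_{\hat0_n}=p_{\hat0_n}$ and $m_{\hat0_n}=e_{\hat1_n}$, where $\hat1_n=12\cdots n$ is the one-block partition) are regarded as members of the family $\{e_\pi\}$. *)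

(* Defs.v *)
From HB Require Import structures.
From mathcomp Require Import boolp classical_sets functions fsbigop.
From mathcomp Require Import all_boot all_order all_algebra.

Set Implicit Arguments.
Unset Strict Implicit.
Unset Printing Implicit Defensive.

Import Order.TTheory GRing.Theory Num.Theory.
Local Open Scope ring_scope.

(* Formal power series over rat in noncommuting variables x_1, x_2, ..., given
   by their coefficients on words.  The letter i : nat stands for x_(i+1), and
   [n] = {1, ..., n} is likewise shifted to 'I_n = {0, ..., n-1}.  The codomain
   is rat^o rather than rat so that the type is an lmodType over rat. *)
Notation ncseries := (seq nat -> rat^o).

Definition ncmonomial n (k : {ffun 'I_n -> nat}) : ncseries :=
  fun w => (w == [seq k i | i <- enum 'I_n])%:R.

(* Sum of the monomials of a possibly infinite set of index tuples.  Each
   coefficient is a finitely supported sum, since a word of length n comes from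
   exactly one tuple (\sum_(k \in A) would be 0 if the support were infinite). *)
Definition ncsum n (A : set {ffun 'I_n -> nat}) : ncseries :=
  fun w => \sum_(k \in A) ncmonomial k w.

(* A labelled graph on n vertices, each vertex identified with its label. *)
Record lgraph (n : nat) := LGraph {
  adj :> rel 'I_n;
  adj_sym : symmetric adj;
  adj_irr : irreflexive adj
}.

Definition proper_colouring n (G : lgraph n) (k : {ffun 'I_n -> nat}) : Prop :=
  forall u v, G u v -> k u <> k v.

Definition ncY n (G : lgraph n) : ncseries :=
  ncsum [set k | proper_colouring G k]%classic.

Record setpart (n : nat) := SetPart {
  blocks :> {set {set 'I_n}};
  setpartP : partition blocks [set: 'I_n]
}.
HB.instance Definition _ n := [isSub for @blocks n].
HB.instance Definition _ n := [Finite of setpart n by <:].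

Definition same_block n (pi : setpart n) (i j : 'I_n) : bool :=
  [exists B in blocks pi, (i \in B) && (j \in B)].

Section PartitionOrder.
Variable n : nat.
Implicit Types pi sigma tau : setpart n.

Definition refines pi sigma : bool :=
  [forall B in blocks pi, exists C in blocks sigma, B \subset C].

Lemma refinesP pi sigma :
  reflect (forall B, B \in blocks pi -> exists2 C, C \in blocks sigma & B \subset C)
          (refines pi sigma).
Proof.
apply: (iffP forall_inP) => H B /H.
  by move=> /exists_inP[C CP BC]; exists C.
by move=> [C CP BC]; apply/exists_inP; exists C.
Qed.

Lemma refines_refl : reflexive refines.
Proof. by move=> pi; apply/refinesP => B BP; exists B. Qed.

Lemma refines_trans : transitive refines.
Proof.
move=> sigma pi tau /refinesP ps /refinesP st; apply/refinesP => B /ps[C /st[D DP CD] BC].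
by exists D => //; apply: subset_trans CD.
Qed.

Lemma refines_anti : antisymmetric refines.
Proof.
have sub pi sigma : refines pi sigma -> refines sigma pi ->
    {subset blocks pi <= blocks sigma}.
  move=> /refinesP ps /refinesP sp B BP.
  have [C CP BC] := ps B BP; have [D DP CD] := sp C CP.
  have /and3P[_ /trivIsetP tP nP] := setpartP pi.
  have BD : B = D.
    apply/eqP; apply: contraT => /(tP _ _ BP DP) dBD.
    have /set0Pn[x xB] : B != finset.set0 by apply: contraNneq nP => <-.
    by have /(_ _ xB) := disjointFr dBD; rewrite (subsetP CD) // (subsetP BC).
  suff -> : B = C by [].
  by apply/eqP; rewrite eqEsubset BC BD.
move=> pi sigma /andP[ps sp]; apply: val_inj; apply/setP => B /=.
by apply/idP/idP; apply: sub.
Qed.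

End PartitionOrder.

HB.instance Definition _ n :=
  Order.Le_isPOrder.Build (Order.Disp tt tt) (setpart n)
    (@refines_refl n) (@refines_anti n) (@refines_trans n).

Lemma singletons_partition n :
  partition [set [set i] | i : 'I_n] [set: 'I_n].
Proof.
apply/and3P; split.
- apply/eqP/setP => i; rewrite in_setT; apply/bigcupP.
  by exists [set i]; rewrite ?set11 // imset_f.
- apply/trivIsetP => _ _ /imsetP[i _ ->] /imsetP[j _ ->] ij.
  by rewrite disjoints1 in_set1; apply: contraNneq ij => ->.
- by apply/imsetP => -[i _ /setP/(_ i)]; rewrite !inE eqxx.
Qed.

Definition part0 n : setpart n := SetPart (singletons_partition n).

Section Mobius.
Variables (d : Order.disp_t) (T : finPOrderType d).
Implicit Types x y z : T.
Local Open Scope order_scope.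

(* The Mobius function of a finite poset, by recursion with fuel k; #|T| is
   always enough fuel, as mobiusE shows. *)
Fixpoint mobius_rec (k : nat) x y : int :=
  if k is k'.+1 then
    if x == y then 1%R
    else if x < y then (- \sum_(z | (x <= z < y)%O) mobius_rec k' x z)%R
    else 0%R
  else 0%R.

Definition mobius x y : int := mobius_rec #|T| x y.

Lemma mobius_recE k l x y :
    (#|[pred z | (z <= y)%O]| <= k)%N -> (#|[pred z | (z <= y)%O]| <= l)%N ->
  mobius_rec k x y = mobius_rec l x y.
Proof.
have c0 (t : T) : (0 < #|[pred z | (z <= t)%O]|)%N by apply/card_gt0P; exists t; rewrite inE.
elim: k l y => [|k IHk] [|l] y; try by rewrite leqNgt c0.
- by move=> _; rewrite leqNgt c0.
move=> kP lP /=; case: eqP => // _; case: ifP => // _; congr (- _)%R.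
apply: eq_bigr => z /andP[_ zy].
have zP : (#|[pred t | (t <= z)%O]| < #|[pred t | (t <= y)%O]|)%N.
  apply/proper_card/properP; split.
    by apply/subsetP => t; rewrite !inE => /le_trans; apply; apply: ltW.
  by exists y; rewrite !inE // lt_geF.
by apply: IHk; rewrite -ltnS; apply: leq_trans zP _.
Qed.

Lemma mobiusE x y :
  mobius x y = if x == y then 1%R
               else if x < y then (- \sum_(z | (x <= z < y)%O) mobius x z)%R
               else 0%R.
Proof.
rewrite /mobius (@mobius_recE #|T| #|T|.+1) ?max_card //.
by apply: leqW; apply: max_card.
Qed.

End Mobius.

Lemma clique_sym n (pi : setpart n) :
  symmetric [rel i j : 'I_n | (i != j) && same_block pi i j].
Proof.
move=> i j /=; rewrite eq_sym; congr (_ && _).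
by apply: eq_existsb => B; rewrite [X in _ && X]andbC.
Qed.

Lemma clique_irr n (pi : setpart n) :
  irreflexive [rel i j : 'I_n | (i != j) && same_block pi i j].
Proof. by move=> i /=; rewrite eqxx. Qed.

(* K_pi *)
Definition clique_graph n (pi : setpart n) : lgraph n :=
  LGraph (clique_sym pi) (clique_irr pi).

Definition ncm n (pi : setpart n) : ncseries :=
  ncsum [set k | forall i j, k i = k j <-> same_block pi i j]%classic.

Definition ncp n (pi : setpart n) : ncseries :=
  ncsum [set k | forall i j, same_block pi i j -> k i = k j]%classic.

Definition nce n (pi : setpart n) : ncseries :=
  ncsum [set k | forall i j, i <> j -> same_block pi i j -> k i <> k j]%classic.

Definition nch n (pi : setpart n) : ncseries :=
  \sum_(sigma : setpart n | (sigma <= pi)%O)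
    `|mobius (part0 n) sigma|%:~R *: ncp sigma.

(* Main.v *)
Require Import Defs.
From mathcomp Require Import boolp classical_sets functions fsbigop.
From mathcomp Require Import all_boot all_order all_algebra.

Set Implicit Arguments.
Unset Strict Implicit.

Import Order.TTheory GRing.Theory Num.Theory.
Local Open Scope ring_scope.

(* The coefficients of Y_G are 0 or 1, and the coefficient on the word
   x_1 x_2 ... x_n is 1.  In c b_pi the latter is c when b = e, which forces
   c = 1; it vanishes for b = m, p unless pi is the minimum, where m_pi and p_pi
   are members of the family e.  In h_pi it is mu(0, 0) = 1, so again c = 1,
   while the coefficient of h_pi on a constant word is the sum of |mu(0, sigma)|
   over sigma <= pi; as the signed sum vanishes for pi <> 0, this is at
   least 2. *)

Definition word n (k : {ffun 'I_n -> nat}) : seq nat :=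
  [seq k i | i <- enum 'I_n].

Lemma size_word n (k : {ffun 'I_n -> nat}) : size (word k) = n.
Proof. by rewrite size_map size_enum_ord. Qed.

Lemma word_inj n : injective (@word n).
Proof.
move=> k l /eq_in_map kl; apply/ffunP => i.
by apply: kl; rewrite mem_enum.
Qed.

(** A word determines its tuple, so at most the term of [k] itself survives. Every later coefficient
    computation thus becomes a membership test on one tuple. *)
Lemma ncsum_word n (A : set {ffun 'I_n -> nat}) k :
  ncsum A (word k) = `[< A k >]%:R.
Proof.
rewrite /ncsum; case: asboolP => Ak.
  rewrite (fsbigE [:: k]) //=.
  - by rewrite big_cons big_nil addr0 /ncmonomial eqxx ifT // mem_set.
  - by move=> l /=; rewrite inE => /eqP->.
  move=> l Al; rewrite /ncmonomial inE => /negP lk.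
  by case: eqP => // /word_inj kl; case: lk; rewrite kl.
apply: fsbig1 => l Al; rewrite /ncmonomial.
by case: eqP => // /word_inj kl; case: Ak; rewrite kl.
Qed.

(** Homogeneity of degree [n]; it lets the degree of the series recover the number of vertices of
    the graph. *)
Lemma ncsum_size n (A : set {ffun 'I_n -> nat}) w :
  size w != n -> ncsum A w = 0.
Proof.
move=> wn; apply: fsbig1 => k _; rewrite /ncmonomial.
by case: eqP => // wk; rewrite wk size_word eqxx in wn.
Qed.

Lemma eq_ncsum n (A B : set {ffun 'I_n -> nat}) :
  (forall k, A k <-> B k) -> ncsum A = ncsum B.
Proof. by move=> AB; congr ncsum; apply/seteqP; split=> k /AB. Qed.

Lemma same_block_refl n (pi : setpart n) i : same_block pi i i.
Proof.
have /and3P[/eqP cP _ _] := setpartP pi.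
have : i \in cover (blocks pi) by rewrite cP inE.
by move=> /bigcupP[B BP iB]; apply/exists_inP; exists B; rewrite ?iB.
Qed.

Lemma same_block_part0 n (i j : 'I_n) : same_block (part0 n) i j = (i == j).
Proof.
apply/idP/eqP => [/exists_inP[_ /imsetP[x _ ->]]|->]; last exact: same_block_refl.
by rewrite !inE => /andP[/eqP-> /eqP->].
Qed.

Lemma part0_le n (pi : setpart n) : (part0 n <= pi)%O.
Proof.
apply/refinesP => _ /imsetP[i _ ->].
have /exists_inP[B BP /andP[iB _]] := same_block_refl pi i.
by exists B; rewrite ?sub1set.
Qed.

Lemma same_block_eq_part0 n (pi : setpart n) :
  (forall i j, same_block pi i j -> i = j) -> pi = part0 n.
Proof.
move=> piP; apply/le_anti/andP; split; last exact: part0_le.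
apply/refinesP => B BP; have /and3P[_ _ nP] := setpartP pi.
have /set0Pn[i iB] : B != finset.set0 by apply: contraNneq nP => <-.
exists [set i]; first exact: imset_f.
apply/subsetP => j jB; rewrite inE eq_sym; apply/eqP/piP.
by apply/exists_inP; exists B; rewrite ?iB.
Qed.

(** The tuple behind the word $x_1x_2\cdots x_n$: being injective, it is a proper colouring of every
    graph. *)
Definition rainbow n : {ffun 'I_n -> nat} := [ffun i => nat_of_ord i].

Lemma rainbow_inj n : injective (rainbow n).
Proof. by move=> i j; rewrite !ffunE => /val_inj. Qed.

Lemma ncY_rainbow n (G : lgraph n) : ncY G (word (rainbow n)) = 1.
Proof.
rewrite /ncY ncsum_word asboolT //= => u v Guv /rainbow_inj uv.
by rewrite uv adj_irr in Guv.
Qed.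

Lemma nce_rainbow n (pi : setpart n) : nce pi (word (rainbow n)) = 1.
Proof. by rewrite /nce ncsum_word asboolT //= => i j ij _ /rainbow_inj. Qed.

Lemma ncm_rainbow n (pi : setpart n) :
  ncm pi (word (rainbow n)) = (pi == part0 n)%:R.
Proof.
rewrite /ncm ncsum_word; congr ((nat_of_bool _)%:R).
apply/asboolP/eqP => /= [piP|-> i j].
  by apply: same_block_eq_part0 => i j /piP /rainbow_inj.
by rewrite same_block_part0; split=> [/rainbow_inj->|/eqP->].
Qed.

Lemma ncp_rainbow n (pi : setpart n) :
  ncp pi (word (rainbow n)) = (pi == part0 n)%:R.
Proof.
rewrite /ncp ncsum_word; congr ((nat_of_bool _)%:R).
apply/asboolP/eqP => /= [piP|-> i j].
  by apply: same_block_eq_part0 => i j /piP /rainbow_inj.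
by rewrite same_block_part0 => /eqP->.
Qed.

Lemma nch_coef n (pi : setpart n) w :
  nch pi w = \sum_(sigma : setpart n | (sigma <= pi)%O)
               `|mobius (part0 n) sigma|%:~R * ncp sigma w.
Proof. by rewrite /nch fct_sumE. Qed.

Lemma mobius_refl (d : Order.disp_t) (T : finPOrderType d) (x : T) :
  mobius x x = 1.
Proof. by rewrite mobiusE eqxx. Qed.

Lemma nch_rainbow n (pi : setpart n) : nch pi (word (rainbow n)) = 1.
Proof.
rewrite nch_coef (bigD1 (part0 n)) ?part0_le //= big1 ?addr0.
  by rewrite ncp_rainbow mobius_refl eqxx.
by move=> sigma /andP[_ /negPf s0]; rewrite ncp_rainbow s0 mulr0.
Qed.

Lemma nch_const n (pi : setpart n) :
  pi != part0 n -> 2 <= nch pi (word [ffun _ : 'I_n => 0%N]).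
Proof.
move=> pi0; rewrite nch_coef.
(* A constant tuple meets every equality constraint, so each $p_\sigma$ has coefficient 1 here and
   the claim is about integers. *)
under eq_bigr => sigma _.
  rewrite /ncp ncsum_word asboolT ?mulr1; last by move=> i j _; rewrite !ffunE.
  over.
rewrite -(rmorph_sum intr) /= -[2]/(2%:~R) ler_int.
have lt0 : (part0 n < pi)%O by rewrite lt_neqAle eq_sym pi0 part0_le.
(* The recursion defines the value at [pi] as minus the sum over the rest of the interval. *)
have sum0 : \sum_(sigma | (sigma <= pi)%O) mobius (part0 n) sigma = 0.
  rewrite (bigD1 pi) //= mobiusE eq_sym (negPf pi0) lt0.
  rewrite addrC; apply/eqP; rewrite subr_eq0; apply/eqP/eq_bigl => sigma.
  by rewrite part0_le lt_neqAle andbC.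
rewrite (bigD1 (part0 n)) ?part0_le //= mobius_refl normr1.
rewrite (bigD1 (part0 n)) ?part0_le //= mobius_refl in sum0.
(* The minimum contributes 1. By [sum0] the other signed values add up to -1, so the triangle
   inequality bounds their absolute values below by 1. *)
rewrite -[2]/(1 + 1) lerD2l; apply: le_trans (ler_norm_sum _ _ _).
by rewrite (_ : \sum_(_ | _) _ = -1) ?normrN ?normr1 //;
  apply/eqP; rewrite -addr_eq0 addrC sum0.
Qed.

(** With singleton blocks both constraints are vacuous, so each side sums over all tuples. *)
Lemma ncp_part0 n : ncp (part0 n) = nce (part0 n).
Proof.
apply: eq_ncsum => k /=; split=> _ i j; rewrite same_block_part0.
  by move=> ij /eqP.
by move=> /eqP->.
Qed.

Lemma nch_part0 n : nch (part0 n) = nce (part0 n).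
Proof.
rewrite -ncp_part0 /nch (big_pred1 (part0 n)); last first.
  by move=> sigma; rewrite /= eq_le part0_le andbT.
by rewrite mobius_refl scale1r.
Qed.

(** The successor matters: for size 0 the single block would be empty. *)
Lemma one_block_partition n :
  partition [set [set: 'I_n.+1]] [set: 'I_n.+1].
Proof.
apply/and3P; split; first by rewrite /cover big_set1.
  by apply/trivIsetP => A B; rewrite !inE => /eqP-> /eqP->; rewrite eqxx.
by rewrite inE eq_sym; apply/set0Pn; exists ord0; rewrite inE.
Qed.

Definition part1 n : setpart n.+1 := SetPart (one_block_partition n).

(** Both sides sum over the injective tuples. *)
Lemma ncm_part0 n : ncm (part0 n.+1) = nce (part1 n).
Proof.
apply: eq_ncsum => k /=; split=> kP i j.
  by move=> ij _ /kP; rewrite same_block_part0 => /eqP.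
rewrite same_block_part0; split=> [kij|/eqP->//].
apply: contraPT kij => /eqP ij; apply: kP ij _.
by apply/exists_inP; exists [set: 'I_n.+1]; rewrite !inE.
Qed.

Lemma nce_clique n (pi : setpart n) : nce pi = ncY (clique_graph pi).
Proof.
apply: eq_ncsum => k; split=> kP i j; first by move=> /andP[/eqP ij]; exact: kP.
by move=> /eqP ij sij; apply: kP; rewrite /= ij.
Qed.

Lemma nch_size n (pi : setpart n) w : size w != n -> nch pi w = 0.
Proof.
by move=> wn; rewrite nch_coef big1 // => sigma _; rewrite /ncp ncsum_size ?mulr0.
Qed.

Theorem theorem5p4 :
  (forall (b : forall n : nat, setpart n -> ncseries),
     [\/ b = nce, b = nch, b = ncm | b = ncp] ->
   forall (n : nat) (pi : setpart n) (c : rat) (m : nat) (G : lgraph m),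
     (1 <= n)%N ->
     c *: b n pi = ncY G ->
     exists (l : nat) (sigma : setpart l), (1 <= l)%N /\ c *: b n pi = nce sigma)
  /\
  (forall (n : nat) (pi : setpart n), (1 <= n)%N -> nce pi = ncY (clique_graph pi)).
Proof.
split=> [b bP n pi c m G n_gt0 cbY|n pi _]; last exact: nce_clique.
have coefE w : c * b n pi w = ncY G w by rewrite -cbY.
have b_size w : size w != n -> b n pi w = 0.
  by case: bP => -> wn; rewrite ?nch_size ?ncsum_size // /nce /ncm /ncp ncsum_size.
(* $Y_G$ has coefficient 1 on a word of length [m], while $c\,b_\pi$ vanishes off length [n]. *)
have mn : m = n.
  have := coefE (word (rainbow m)); rewrite ncY_rainbow.
  case: (eqVneq m n) => // mn.
  by rewrite b_size ?size_word // mulr0 => /esym/eqP; rewrite oner_eq0.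
subst m; have := coefE (word (rainbow n)); rewrite ncY_rainbow.
case: bP => bE; rewrite bE in coefE *.
- by rewrite nce_rainbow mulr1 => ->; exists n, pi; rewrite scale1r.
- rewrite nch_rainbow mulr1 => c1; exists n, (part0 n); split=> //.
  rewrite c1 scale1r; case: (eqVneq pi (part0 n)) => [->|pi0].
    exact: nch_part0.
  (* With $c=1$, the coefficient on the constant word would be at least 2, yet in $Y_G$ it is 0 or
     1. *)
  have := nch_const pi0; have := coefE (word [ffun _ : 'I_n => 0%N]).
  by rewrite c1 mul1r => ->; rewrite /ncY ncsum_word; case: asboolP.
- rewrite ncm_rainbow; case: eqP => [->|_]; rewrite ?mulr0 ?mulr1; last first.
    by move=> /esym/eqP; rewrite oner_eq0.
  (* Writing [n] as a successor makes the one-block partition available as witness. *)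
  clear -n_gt0; case: n n_gt0 => // n _ ->.
  by exists n.+1, (part1 n); rewrite scale1r ncm_part0.
- rewrite ncp_rainbow; case: eqP => [->|_]; rewrite ?mulr0 ?mulr1; last first.
    by move=> /esym/eqP; rewrite oner_eq0.
  by move=> ->; exists n, (part0 n); rewrite scale1r ncp_part0.
Qed.
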